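(* Let $T>0$, let $\Phi(x,t)$ be such that $\Phi_t=\Phi(B_t,t)$ is a non-anticipating process, and suppose that either $\Phi_t\in\mathscr{L}_0$, or $\Phi_t\in\mathscr{L}_2$ and $t\mapsto E[\Phi_t^4]$ is bounded on $[0,T]$. Let $K\ge1$ be a fixed natural number. For each partition $\triangle_n:0=t_0<t_1<\cdots<t_n=T$ with $n>K$, let $J=\{0,\dots,n-1\}$ and let $J_K\subset J$ be any subset with exactly $K$ elements. Then $$\mathop{\mathrm{l.i.m.}}_{\|\triangle_n\|\to0}\ \sum_{j\in J\setminus J_K}\Phi\Big(\frac{B_{t_j}+B_{t_{j+1}}}{2},t_j\Big)(B_{t_{j+1}}-B_{t_j})=\int_0^T\Phi_t\circ dB_t .$$
   Context: $(\Omega,\mathcal F,(\mathcal F_t),P)$ is a probability space with a complete right-continuous filtration generated by a one-dimensional standard Brownian motion $B=(B_t)$, each $\mathcal F_t$ containing all $P$-null sets. $\mathrm{l.i.m.}$ denotes limit in mean square, i.e. in $L^2(\Omega,P)$; $\|\triangle_n\|=\max_{0\le i\le n-1}(t_{i+1}-t_i)$. Classes of integrands: - $\mathscr{L}_0$: processes of the form $\Phi_t(\omega)=f_0(\omega)I_{\{0\}}(t)+\sum_{k=0}^\infty f_k(\omega)I_{(s_k,s_{k+1}]}(t)$ with $0=s_0<s_1<\cdots\uparrow\infty$, $f_k$ being $\mathcal F_{s_k}$-measurable, and the $f_k$ uniformly bounded. - $\mathscr{L}_2$: measurable $(\mathcal F_t)$-adapted processes with $\mathbb E\int_0^T|\Phi_t|^2dt<\infty$.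 The Stratonovich integral of a non-anticipating process $\Phi_t=\Phi(B_t,t)$ is $\int_0^T\Phi_t\circ dB_t=\mathop{\mathrm{l.i.m.}}_{\|\triangle_n\|\to0}\sum_{i=0}^{n-1}\Phi\big(\tfrac{B_{t_i}+B_{t_{i+1}}}{2},t_i\big)(B_{t_{i+1}}-B_{t_i})$.
   Formalization: The formal theorem additionally assumes that x ↦ Φ(x,0) is bounded near x = 0; without this the claim fails, e.g. Φ(x,0)=1/x for x≠0, Φ(0,0)=0 and Φ(x,t)=0 for t>0, with 0 in J_K. *)

(* Defs.v *)
From HB Require Import structures.
From mathcomp Require Export all_boot all_order all_algebra.
From mathcomp Require Export all_classical all_reals all_analysis.

Set Implicit Arguments.
Unset Strict Implicit.
Unset Printing Implicit Defensive.

Export Order.TTheory GRing.Theory Num.Theory.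
Export numFieldNormedType.Exports.

Local Open Scope classical_set_scope.
Local Open Scope ring_scope.

Section brownian_motion.
Context (d : measure_display) (Om : measurableType d) (R : realType)
  (P : probability Om R).

Definition increment (B : R -> Om -> R) (s t : R) (w : Om) : R := B t w - B s w.

(* Time is [0, +oo[; values at negative times are irrelevant throughout. *)
Record standard_brownian_motion (B : R -> {RV P >-> R}) : Prop := {
  bm_start : {ae P, forall w, B 0 w = 0} ;
  bm_gaussian_increments : forall s t : R, 0 <= s -> s < t ->
    forall A : set R, measurable A ->
      P (increment B s t @^-1` A) =
      normal_prob 0 (Num.sqrt (t - s)) A ;
  (* Some of the A i may be setT, so this covers all subfamilies. *)
  bm_independent_increments : forall (n : nat) (t : nat -> R),
    0 <= t 0%N -> (forall i, (i < n)%N -> t i < t i.+1) ->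
    forall A : nat -> set R, (forall i, measurable (A i)) ->
      P (\bigcap_(i < n) (increment B (t i) (t i.+1) @^-1` A i)) =
      (\prod_(i < n) P (increment B (t i) (t i.+1) @^-1` A i))%E ;
  bm_continuous_paths :
    {ae P, forall w, {within `[0, +oo[, continuous (fun t => B t w)}}
}.

Definition augmented_sigma (B : R -> Om -> R) (t : R) : set (set Om) :=
  <<s [set E | exists (s : R) (A : set R),
         [/\ 0 <= s <= t, measurable A & E = B s @^-1` A]] `|`
      [set N | measurable N /\ P N = 0%E] >>.

(* Smallest right-continuous filtration that contains the null sets and to
   which B is adapted. *)
Definition brownian_filtration (B : R -> Om -> R) (t : R) : set (set Om) :=
  \bigcap_(u in [set u | t < u]) augmented_sigma B u.

End brownian_motion.

Section processes.
Context (d : measure_display) (Om : measurableType d) (R : realType).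
Implicit Types (F : R -> set (set Om)) (X : R -> Om -> R).

Definition sigma_measurable (G : set (set Om)) (f : Om -> R) : Prop :=
  forall A : set R, measurable A -> G (f @^-1` A).

Definition adapted F X : Prop :=
  forall t : R, 0 <= t -> sigma_measurable (F t) (X t).

Definition in_L0 F X : Prop :=
  exists (s : nat -> R) (f : nat -> Om -> R),
    [/\ s 0%N = 0 /\ (forall k, s k < s k.+1) /\ s @ \oo --> +oo,
        forall k, sigma_measurable (F (s k)) (f k),
        exists M : R, forall k w, `|f k w| <= M &
        forall (t : R) w, 0 <= t ->
          X t w = f 0%N w * \1_[set 0] t +
                  limn (fun n =>
                    \sum_(0 <= k < n) f k w * \1_(`]s k, s k.+1]) t)].

Definition in_L2 (P : probability Om R) F (T : R) X : Prop :=
  [/\ measurable_fun ([set t : R | 0 <= t] `*` [set: Om]) (fun p : R * Om => X p.1 p.2),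
      adapted F X &
      (\int[P]_w \int[lebesgue_measure]_(t in `[0%R, T]) ((`|X t w| ^+ 2)%:E)
         < +oo)%E].

End processes.

Section mean_square.
Context (d : measure_display) (Om : measurableType d) (R : realType)
  (P : probability Om R).

(* Membership in Lfun includes measurability. *)
Definition lim_in_mean_square (I : Type) (F : set_system I)
    (S : I -> Om -> R) (Y : Om -> R) : Prop :=
  [/\ \forall i \near F, S i \in Lfun P 2%:E,
      Y \in Lfun P 2%:E &
      ('E_P[fun w => ((S i w - Y w) ^+ 2)%R])%E @[i --> F] --> 0%E].

End mean_square.

Section stratonovich.
Context (R : realType).

(* A partition 0 = t_0 < ... < t_n = T is given, as in itv_partition 0 T s, by
   the sequence s = [:: t_1; ...; t_n]; thus n = size s. *)
Definition node (s : seq R) (i : nat) : R := nth 0 (0 :: s) i.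

Definition mesh (s : seq R) : R :=
  \big[Num.max/0]_(i < size s) (node s i.+1 - node s i).

Definition mesh_to_0 (T : R) : set_system (seq R) :=
  [set U | exists2 delta : R, 0 < delta &
     forall s, itv_partition 0 T s -> mesh s < delta -> U s].

#[global] Instance mesh_to_0_filter (T : R) : Filter (mesh_to_0 T).
Proof.
split.
- by exists 1.
- move=> U V [e e0 HU] [f f0 HV]; exists (Num.min e f).
    by rewrite lt_min e0.
  by move=> s Hs; rewrite lt_min => /andP[? ?]; split; [exact: HU|exact: HV].
- by move=> U V UV [e e0 HU]; exists e => // s ? ?; exact/UV/HU.
Qed.

Context (d : measure_display) (Om : measurableType d) (P : probability Om R).

Definition midpoint_sum (B : R -> Om -> R) (Phi : R -> R -> R) (s : seq R)
    (A : {set 'I_(size s)}) (w : Om) : R :=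
  \sum_(j in A) Phi ((B (node s j) w + B (node s j.+1) w) / 2) (node s j) *
                (B (node s j.+1) w - B (node s j) w).

(* Y is (a version of) the Stratonovich integral of Phi(B_t, t) over [0, T]. *)
Definition is_stratonovich_integral (B : R -> Om -> R) (T : R)
    (Phi : R -> R -> R) (Y : Om -> R) : Prop :=
  lim_in_mean_square P (mesh_to_0 T)
    (fun s => midpoint_sum B Phi [set: 'I_(size s)]%SET) Y.

End stratonovich.

(* Main.v *)
(* It suffices that single terms of the midpoint sums vanish in mean square as
   the mesh tends to 0, uniformly in the partition: at most K are removed.

   If 0 < b - a <= a, then B_a and B_b - B_a are independent Gaussians, and the
   fourth moment bound on Phi(B_a, a) dominates the second moment of the term
   of [a, b] by 8 (C + 1) (b - a), because the midpoint only shifts the law of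
   B_a by half of the increment. If b - a > a this second moment need not be
   finite a priori, since the law of the midpoint is then too spread out
   compared to that of B_a. Convergence over all partitions helps: refining one
   interval [a, b] of a partition of small mesh changes the midpoint sum by
   little, so the term of [a, b] is close to the sum of the terms of any
   subdivision of [a, b]. A dyadic subdivision a < ... < b/4 < b/2 < b has all
   its ratios small enough for the Gaussian bound, and its sum is
   O(sqrt(b - a)) in L^2. When a = 0 the subdivision starts with [0, r], whose
   term tends to 0 almost surely as r -> 0 because Phi(., 0) is bounded near 0,
   and Fatou's lemma concludes. *)
From HB Require Import structures.
Require Import Defs.
From mathcomp Require Import ring lra measurable_realfun.

Set Implicit Arguments.
Unset Strict Implicit.
Unset Printing Implicit Defensive.

Local Open Scope classical_set_scope.
Local Open Scope ring_scope.

(** * Gaussian integrals *)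

Section gaussian.
Context {R : realType}.
Local Notation mu := (@lebesgue_measure R).

(** The Radon-Nikodym derivative of [normal_prob] equals [normal_pdf] almost everywhere, because
    both have the same integral over every measurable set. *)
Lemma ge0_integral_normal_prob (m s : R) (f : R -> \bar R) :
  (forall x, 0 <= f x)%E -> measurable_fun setT f ->
  (\int[normal_prob m s]_x f x = \int[mu]_x (f x * (normal_pdf m s x)%:E))%E.
Proof.
move=> f0 mf; have dom := normal_prob_dominates m s.
have mpdf : measurable_fun setT (EFin \o normal_pdf m s).
  by apply/measurable_EFinP; exact: measurable_normal_pdf.
rewrite -(Radon_Nikodym_SigmaFinite.change_of_variables dom)//.
have mRN := measurable_int _ (Radon_Nikodym_SigmaFinite.f_integrable dom).
apply: ae_eq_integral => //; [exact: emeasurable_funM..|].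
apply: ae_eqe_mul2l; apply: integral_ae_eq => //.
  exact: Radon_Nikodym_SigmaFinite.f_integrable.
by move=> A _ mA; rewrite -Radon_Nikodym_SigmaFinite.f_integral.
Qed.

(** The image of Lebesgue measure under the shift gives half-open intervals their length, so it is
    Lebesgue measure by uniqueness. *)
Lemma ge0_integral_addr (f : R -> \bar R) (a : R) :
  (forall x, 0 <= f x)%E -> measurable_fun setT f ->
  (\int[mu]_x f (x + a)%R = \int[mu]_x f x)%E.
Proof.
move=> f0 mf.
pose shift (x : measurableTypeR R) : measurableTypeR R := x + a.
have mshift : measurable_fun setT shift by exact: measurable_funD.
have -> : (\int[mu]_x f (x + a)%R = \int[pushforward mu shift]_x f x)%E.
  by rewrite ge0_integral_pushforward.
apply: eq_measure_integral => A mA _; apply/esym/lebesgue_measure_unique => //.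
move=> _ [[b c]] _ <-.
transitivity (mu (shift @^-1` `]b, c])); last by [].
have -> : shift @^-1` `]b, c]%classic = `]b - a, c - a]%classic.
  by apply/seteqP; split => x /=; rewrite !in_itv/= ltrBlDr lerBrDr.
rewrite !lebesgue_measure_itv/= !lte_fin ltrD2r.
by case: ifP => // _; rewrite -!EFinD; congr EFin; lra.
Qed.

(* Pointwise, [2 g^2 p_a <= g^4 p_0 + p_a^2 / p_0] for the Gaussian densities
   p_c of mean c, and p_a^2 / p_0 is again a multiple of the density p_(2a). *)
Lemma normal_prob_shift_le (s a C : R) (g : R -> R) : 0 < s ->
  measurable_fun setT g ->
  (\int[normal_prob 0 s]_x (g x ^+ 4)%:E <= C%:E)%E ->
  (\int[normal_prob 0 s]_x (g (x + a) ^+ 2)%:E <=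
     (2^-1 * (C + expR (a ^+ 2 / s ^+ 2)))%:E)%E.
Proof.
move=> s0 mg gC.
have s1 : s != 0 by rewrite gt_eqF.
have mpdf c : measurable_fun setT (EFin \o normal_pdf c s).
  by apply/measurable_EFinP; exact: measurable_normal_pdf.
have mgX n : measurable_fun setT (EFin \o (fun x => g x ^+ n)).
  exact/measurable_EFinP/measurable_funX.
rewrite ge0_integral_normal_prob; first last.
- apply/measurable_EFinP/measurable_funX; apply: measurableT_comp => //.
  exact: measurable_funD.
- by move=> x; rewrite lee_fin sqr_ge0.
pose G x := ((g x ^+ 2)%:E * (normal_pdf a s x)%:E)%E.
have mG : measurable_fun setT G by exact: emeasurable_funM (mgX 2) (mpdf a).
have G0 x : (0 <= G x)%E.
  by apply: mule_ge0; rewrite lee_fin ?sqr_ge0 ?normal_pdf_ge0.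
have -> : (\int[mu]_x ((g (x + a)%R ^+ 2)%:E * (normal_pdf 0 s x)%:E) =
    \int[mu]_x G x)%E.
  rewrite -(ge0_integral_addr a G0 mG); apply: eq_integral => x _.
  by rewrite /G !normal_pdfE// /normal_fun subr0 addrK.
(* The density of mean [2a] has mass 1, so the exponential can be written as the integral of p_a^2 /
   p_0. *)
have -> : (2^-1 * (C + expR (a ^+ 2 / s ^+ 2)))%:E = (2^-1%:E * (C%:E +
    \int[mu]_x ((expR (a ^+ 2 / s ^+ 2))%:E * (normal_pdf (a *+ 2) s x)%:E)))%E.
  rewrite ge0_integralZl ?lee_fin ?expR_ge0//; last 2 first.
  - exact: mpdf.
  - by move=> x _; rewrite lee_fin normal_pdf_ge0.
  by rewrite /= integral_normal_pdf mule1.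
have E0 x : (0 <= (expR (a ^+ 2 / s ^+ 2))%:E * (normal_pdf (a *+ 2) s x)%:E)%E.
  by apply: mule_ge0; rewrite lee_fin ?expR_ge0 ?normal_pdf_ge0.
have g40 x : (0 <= (g x ^+ 4)%:E * (normal_pdf 0 s x)%:E)%E.
  by apply: mule_ge0; rewrite lee_fin ?normal_pdf_ge0// exprn_even_ge0.
apply: (@le_trans _ _ (2^-1%:E *
    (\int[mu]_x ((g x ^+ 4)%:E * (normal_pdf 0 s x)%:E) +
     \int[mu]_x ((expR (a ^+ 2 / s ^+ 2))%:E *
                 (normal_pdf (a *+ 2) s x)%:E))))%E.
  have mg4 : measurable_fun setT
      (fun x => (g x ^+ 4)%:E * (normal_pdf 0 s x)%:E)%E.
    exact: emeasurable_funM (mgX 4) (mpdf 0).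
  have mE : measurable_fun setT
      (fun x => (expR (a ^+ 2 / s ^+ 2))%:E * (normal_pdf (a *+ 2) s x)%:E)%E.
    by apply: measurable_funeM; exact: mpdf.
  rewrite -ge0_integralD// -ge0_integralZl//; last 2 first.
  - exact: emeasurable_funD.
  - by move=> x _; rewrite adde_ge0.
  apply: ge0_le_integral => //.
  - by apply: measurable_funeM; exact: emeasurable_funD.
  - move=> x _; rewrite /G -!EFinM lee_fin !normal_pdfE//.
    set N := normal_peak s; have N0 : 0 < N by exact: normal_peak_gt0.
    set p0 := normal_fun 0 s x; set pa := normal_fun a s x.
    set p2 := normal_fun _ s x; set E := expR _.
    have p00 : 0 < p0 by exact: expR_gt0.
    have pE : E * p2 * p0 = pa ^+ 2.
      rewrite /E /p2 /p0 /pa /normal_fun -!expRD -expRM_natl; congr expR.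
      by field.
    have : 0 <= (g x ^+ 2 * p0 - pa) ^+ 2 by exact: sqr_ge0.
    rewrite sqrrB -pE => H.
    have {}H : 0 <= p0 * (g x ^+ 4 * p0 - (g x ^+ 2 * pa) *+ 2 + E * p2).
      by rewrite [leRHS](_ : _ = (g x ^+ 2 * p0) ^+ 2 -
        (g x ^+ 2 * p0 * pa) *+ 2 + E * p2 * p0)//; ring.
    rewrite pmulr_rge0// in H.
    have : 0 <= N * (g x ^+ 4 * p0 - (g x ^+ 2 * pa) *+ 2 + E * p2).
      by rewrite mulr_ge0// ltW.
    lra.
rewrite lee_wpmul2l// ?lee_fin ?invr_ge0// leeD2r//.
rewrite -ge0_integral_normal_prob//; last exact: (mgX 4).
by move=> x; rewrite lee_fin exprn_even_ge0.
Qed.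

(** Integrates the bound of [normal_prob_shift_le], for the shift [y / 2], against the law of the
    increment [y]. As [r <= s], the growing exponential uses up at most half of the exponent of the
    density. Half of the rest absorbs [y ^+ 2], and what remains is a multiple of the density of
    deviation [2 * r]. *)
Lemma integral_sqr_expR_normal_prob_le (s r C : R) :
  0 < r -> r <= s -> 0 <= C ->
  (\int[normal_prob 0 r]_y
     (y ^+ 2 * (2^-1 * (C + expR ((y / 2) ^+ 2 / s ^+ 2))))%:E <=
   (8 * (C + 1) * r ^+ 2)%:E)%E.
Proof.
move=> r0 rs C0.
have r1 : r != 0 by rewrite gt_eqF.
have s0 : 0 < s by exact: lt_le_trans rs.
have mexp : measurable_fun setT (EFin \o (fun y : R =>
    y ^+ 2 * (2^-1 * (C + expR ((y / 2) ^+ 2 / s ^+ 2))))).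
  apply/measurable_EFinP/measurable_funM => //.
  apply: measurable_funM => //; apply: measurable_funD => //.
  apply: measurableT_comp => //; apply: measurable_funM => //.
  by apply: measurable_funX; exact: measurable_funM.
have f0 y : 0 <= y ^+ 2 * (2^-1 * (C + expR ((y / 2) ^+ 2 / s ^+ 2))).
  rewrite mulr_ge0 ?sqr_ge0// mulr_ge0 ?invr_ge0//.
  by rewrite addr_ge0 ?expR_ge0.
rewrite ge0_integral_normal_prob//.
have mpdf (c t : R) : measurable_fun setT (EFin \o normal_pdf c t).
  by apply/measurable_EFinP; exact: measurable_normal_pdf.
have -> : (8 * (C + 1) * r ^+ 2)%:E =
    (\int[mu]_y ((8 * (C + 1) * r ^+ 2)%:E * (normal_pdf 0 (2 * r) y)%:E))%E.
  rewrite ge0_integralZl ?lee_fin//; last 3 first.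
  - exact: mpdf.
  - by move=> x _; rewrite lee_fin normal_pdf_ge0.
  - by rewrite mulr_ge0 ?sqr_ge0// mulr_ge0// addr_ge0.
  by rewrite /= integral_normal_pdf mule1.
apply: ge0_le_integral => //.
- by move=> y _; apply: mule_ge0; rewrite lee_fin ?normal_pdf_ge0.
- exact: emeasurable_funM mexp (mpdf 0 r).
- by apply: measurable_funeM; exact: mpdf.
move=> y _; rewrite -!EFinM lee_fin !normal_pdfE// ?mulf_neq0//.
have -> : normal_peak (2 * r) = normal_peak r / 2.
  rewrite /normal_peak exprMn -mulrA -mulrnAr sqrtrM ?sqr_ge0// sqrtr_sqr.
  by rewrite ger0_norm// invfM mulrC.
set N := normal_peak r; have N0 : 0 < N by exact: normal_peak_gt0.
set q := normal_fun 0 (2 * r) y; set p := normal_fun 0 r y.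
(* In this unit the density of deviation [2 * r] is proportional to exp(-z), that of deviation [r]
   to exp(-4z), and the growing exponential is at most exp(2z). *)
set z := y ^+ 2 / (8 * r ^+ 2).
have z0 : 0 <= z by rewrite divr_ge0 ?sqr_ge0// mulr_ge0// sqr_ge0.
have yz : y ^+ 2 = 8 * r ^+ 2 * z by rewrite /z; field.
have qz : q = expR (- z).
  by rewrite /q /normal_fun subr0 /z; congr expR; field.
have pz : p = expR (- z) ^+ 4.
  by rewrite /p /normal_fun subr0 /z -expRM_natl; congr expR; field.
have ez : z * expR (- z) <= 1.
  rewrite expRN ler_pdivrMr ?expR_gt0// mul1r.
  by apply: le_trans (expR_ge1Dx z); rewrite lerDr.
have es : expR ((y / 2) ^+ 2 / s ^+ 2) <= expR z ^+ 2.
  rewrite -expRM_natl ler_expR; rewrite /z.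
  have -> : 2%:R * (y ^+ 2 / (8 * r ^+ 2)) = (y / 2) ^+ 2 / r ^+ 2 by field.
  rewrite ler_wpM2l ?sqr_ge0// lef_pV2 ?posrE ?exprn_gt0//.
  by rewrite lerXn2r// ?nnegrE ltW.
have e1 : expR z * expR (- z) = 1 by rewrite expRxMexpNx_1.
set e := expR z in es e1; set f := expR (- z) in qz pz ez e1.
have fgt0 : 0 < f by exact: expR_gt0.
have e11 : 1 <= e by rewrite /e -expR0 ler_expR.
rewrite qz pz yz; set D := expR _ in es *.
apply: (@le_trans _ _
    (8 * r ^+ 2 * z * (2^-1 * ((C + 1) * e ^+ 2)) * (N * f ^+ 4))).
  rewrite ler_wpM2r//; first by rewrite mulr_ge0 ?exprn_ge0// ltW.
  rewrite ler_wpM2l//; first by rewrite mulr_ge0// mulr_ge0// sqr_ge0.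
  rewrite ler_wpM2l ?invr_ge0// mulrDl mul1r lerD// ler_peMr//.
  by rewrite exprn_ege1.
have -> : 8 * r ^+ 2 * z * (2^-1 * ((C + 1) * e ^+ 2)) * (N * f ^+ 4) =
    (8 * (C + 1) * r ^+ 2 * (N / 2) * f) * (z * f) * (e * f) ^+ 2.
  by field.
rewrite e1 expr1n mulr1 [leRHS]mulrA ler_piMr//.
rewrite mulr_ge0 ?ltW// mulr_gt0 ?divr_gt0// mulr_gt0 ?exprn_gt0//.
by rewrite mulr_gt0// ltr_wpDl.
Qed.

End gaussian.

(** * Integration over an independent pair *)

Section independent_pair.
Context d1 d2 d (T1 : measurableType d1) (T2 : measurableType d2)
  (Om : measurableType d) (R : realType) (P : probability Om R).
Variables (m1 : probability T1 R) (m2 : probability T2 R).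

(** The joint law agrees with the product measure on rectangles, hence everywhere, and Tonelli
    applies. [Y] is integrated last, so that the inner integral sees a fixed shift. *)
Lemma ge0_integral_independent_pair (X : Om -> T1) (Y : Om -> T2)
    (f : T1 * T2 -> \bar R) :
  measurable_fun setT X -> measurable_fun setT Y ->
  (forall A B, measurable A -> measurable B ->
     P (X @^-1` A `&` Y @^-1` B) = (m1 A * m2 B)%E) ->
  (forall z, 0 <= f z)%E -> measurable_fun setT f ->
  (\int[P]_w f (X w, Y w) = \int[m2]_y \int[m1]_x f (x, y))%E.
Proof.
move=> mX mY XY f0 mf.
have mXY : measurable_fun setT (fun w => (X w, Y w)).
  exact/measurable_fun_pairP.
rewrite -(@fubini_tonelli2 _ _ _ _ _ m1 m2 f)//.
pose XYm := isMeasurableFun.Build _ _ _ _ _ mXY.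
pose XYf : {mfun Om >-> (T1 * T2)%type} := HB.pack (fun w => (X w, Y w)) XYm.
transitivity (\int[distribution P XYf]_z f z)%E.
  by rewrite ge0_integral_pushforward.
by apply: eq_measure_integral => A mA _; exact/esym/product_measure_unique.
Qed.

End independent_pair.

(** * Second moments *)

Section mean_square_estimates.
Context d (Om : measurableType d) (R : realType) (P : probability Om R).

Definition sqnorm (X : Om -> R) : \bar R := (\int[P]_w (X w ^+ 2)%:E)%E.

Lemma measurable_EFin_sqr (X : Om -> R) : measurable_fun setT X ->
  measurable_fun setT (fun w => (X w ^+ 2)%:E).
Proof. by move=> mX; apply/measurable_EFinP; exact: measurable_funX. Qed.

Lemma sqnorm_ge0 (X : Om -> R) : (0 <= sqnorm X)%E.
Proof. by apply: integral_ge0 => w _; rewrite lee_fin sqr_ge0. Qed.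

Lemma sqnormN (X : Om -> R) : sqnorm (\- X) = sqnorm X.
Proof. by apply: eq_integral => w _; rewrite sqrrN. Qed.

(* The unequal weights make the dyadic induction of [dyadic_refinement] close. *)
Lemma sqnormD_le (X Y : Om -> R) (x y : R) :
  measurable_fun setT X -> measurable_fun setT Y ->
  (sqnorm X <= x%:E)%E -> (sqnorm Y <= y%:E)%E ->
  (sqnorm (X \+ Y)%R <= (3 / 2 * x + 3 * y)%:E)%E.
Proof.
move=> mX mY Xx Yy.
have X0 w : (0 <= (X w ^+ 2)%:E)%E by rewrite lee_fin sqr_ge0.
have Y0 w : (0 <= (Y w ^+ 2)%:E)%E by rewrite lee_fin sqr_ge0.
have mX2 := measurable_EFin_sqr mX; have mY2 := measurable_EFin_sqr mY.
apply: (@le_trans _ _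
    (\int[P]_w ((3 / 2)%:E * (X w ^+ 2)%:E + 3%:E * (Y w ^+ 2)%:E))%E).
  apply: ge0_le_integral => //.
  - by move=> w _; rewrite lee_fin sqr_ge0.
  - by apply: measurable_EFin_sqr; exact: measurable_funD.
  - by apply: emeasurable_funD; exact: measurable_funeM.
  - move=> w _; rewrite -!EFinM lee_fin /=.
    (* The difference of the two sides is half of this square. *)
    have := sqr_ge0 (X w - 2 * Y w); nra.
rewrite ge0_integralD//; last 4 first.
- by move=> w _; rewrite mule_ge0// lee_fin.
- exact: measurable_funeM.
- by move=> w _; rewrite mule_ge0// lee_fin.
- exact: measurable_funeM.
rewrite !ge0_integralZl ?lee_fin//.
rewrite [leRHS](_ : _ = (3 / 2)%:E * x%:E + 3%:E * y%:E)%E//.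
by rewrite leeD// lee_wpmul2l ?lee_fin.
Qed.

(** The crude factor 5 per term is harmless because the number of removed terms is fixed; it works
    since 3/2 + 3 * 5^n <= 5^(n+1). *)
Lemma sqnorm_sum_le (I : Type) (r : seq I) (X : I -> Om -> R) (x : R) :
  (forall i, measurable_fun setT (X i)) -> 0 <= x ->
  (forall i, (sqnorm (X i) <= x%:E)%E) ->
  (sqnorm (fun w => \sum_(i <- r) X i w)%R <= (5 ^+ size r * x)%:E)%E.
Proof.
move=> mX x0 Xx; elim: r => [|i r IHr].
  rewrite /sqnorm; under eq_integral do rewrite big_nil expr0n/=.
  by rewrite integral0 lee_fin mul1r.
have := sqnormD_le (mX i) (measurable_sum r mX) (Xx i) IHr.
rewrite [X in (sqnorm X <= _)%E -> _](_ : _ =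
    fun w => \sum_(j <- i :: r) X j w).
  move=> /le_trans; apply; rewrite lee_fin /= exprS.
  have : 1 <= 5 ^+ size r :> R by rewrite exprn_ege1// ler1n.
  set e := 5 ^+ _ => e1; nra.
by apply/funext => w; rewrite big_cons.
Qed.

(** Fatou's lemma for the squares of [X - Z k], which tend to the square of [X] almost surely; no
    second moment of [Z k] has to be controlled. *)
Lemma sqnorm_le_fatou (X : Om -> R) (Z : (Om -> R)^nat) (x : R) :
  measurable_fun setT X -> (forall k, measurable_fun setT (Z k)) ->
  {ae P, forall w, Z k w @[k --> \oo] --> 0} ->
  (forall k, (sqnorm (X \- Z k)%R <= x%:E)%E) -> (sqnorm X <= x%:E)%E.
Proof.
move=> mX mZ Z0 XZ.
pose f k w := (((X \- Z k) w) ^+ 2)%:E.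
have mf k : measurable_fun setT (f k).
  by apply: measurable_EFin_sqr; exact: measurable_funB.
have f0 k w : (0 <= f k w)%E by rewrite lee_fin sqr_ge0.
apply: (@le_trans _ _ (\int[P]_w limn_einf (f^~ w))%E).
  apply: ae_ge0_le_integral => //.
  - by move=> w _; rewrite lee_fin sqr_ge0.
  - exact: measurable_EFin_sqr.
  - move=> w _; rewrite limn_einf_lim; apply: lime_ge.
      exact: is_cvg_einfs.
    by apply: nearW => n; apply: le_ereal_inf_tmp => _ [k _ <-]; exact: f0.
  - apply: measurableT_comp => //.
    apply: (@measurable_fun_limn_esup _ _ _ _ (fun k w => - f k w)%E) => k.
    exact: measurableT_comp.
  - move: Z0; apply: filterS => w Zw _.
    have fw : f k w @[k --> \oo] --> (X w ^+ 2)%:E.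
      apply: cvg_EFin; first exact: nearW.
      rewrite [X in _ --> X](_ : _ = (X w - 0) ^+ 2); last by rewrite subr0.
      have XZw : X w - Z k w @[k --> \oo] --> X w - 0.
        by apply: cvgB => //; exact: cvg_cst.
      apply: (cvg_comp (fun k => X w - Z k w) (fun x => x ^+ 2)) XZw _.
      exact: sqr_continuous.
    by rewrite (cvg_limn_einf_sup fw).1.
apply: le_trans (fatou _ measurableT mf _) _ => //.
rewrite limn_einf_lim; apply: lime_le; first exact: is_cvg_einfs.
apply: nearW => n; apply: ge_ereal_inf.
by exists (\int[P]_w f n w)%E; [exists n => /=|exact: XZ].
Qed.

End mean_square_estimates.

(** * Subdivisions and Brownian increments *)

Section midpoint_terms.
Context d (Om : measurableType d) (R : realType) (P : probability Om R).
Variables (B : R -> {RV P >-> R}) (Phi : R -> R -> R).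

Definition midpoint_term (a b : R) (w : Om) : R :=
  Phi ((B a w + B b w) / 2) a * (B b w - B a w).

(** Recursion on the list of nodes replaces the sum over ordinals, so that inserting nodes becomes a
    matter of concatenation. *)
Fixpoint chain_sum (a : R) (l : seq R) (w : Om) : R :=
  if l is b :: l' then midpoint_term a b w + chain_sum b l' w else 0.

Lemma chain_sum_cat (a : R) (l1 l2 : seq R) (w : Om) :
  chain_sum a (l1 ++ l2) w = chain_sum a l1 w + chain_sum (last a l1) l2 w.
Proof. by elim: l1 a => [|b l1 IH] a /=; rewrite ?add0r// IH addrA. Qed.

Lemma midpoint_sum_setT (s : seq R) :
  midpoint_sum B Phi [set: 'I_(size s)]%SET = chain_sum 0 s.
Proof.
apply/funext => w; rewrite /midpoint_sum.
under eq_bigl do rewrite finset.in_setT.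
suff sumE a : \sum_(i < size s)
    midpoint_term (nth 0 (a :: s) i) (nth 0 (a :: s) i.+1) w = chain_sum a s w.
  exact: sumE.
elim: s a => [|b s IH] a /=; first by rewrite big_ord0.
by rewrite big_ord_recl /= -IH.
Qed.

(** As a [path] condition, a bound on the mesh splits along concatenations. *)
Lemma path_mesh (delta : R) (s : seq R) : mesh s < delta ->
  path (fun x y => y - x < delta) 0 s.
Proof.
move=> sd; apply/(pathP 0) => i si.
apply: le_lt_trans sd.
exact: (le_bigmax _ (fun j : 'I_(size s) => node s j.+1 - node s j)
                  (Ordinal si)).
Qed.

Lemma mesh_path (delta : R) (s : seq R) : 0 < delta ->
  path (fun x y => y - x < delta) 0 s -> mesh s < delta.
Proof.
move=> d0 /(pathP 0) sd; apply: bigmax_lt => // i _.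
exact: sd.
Qed.

Lemma path_mesh_lt (delta a : R) (l : seq R) : path <%R a l ->
  last a l - a < delta -> path (fun x y => y - x < delta) a l.
Proof.
elim: l a => [//|x l IH] a /= /andP[ax xl] ld.
have xlast : x <= last x l by apply: (@itv_partition_le _ _ _ _ l); split.
by rewrite IH// ?andbT; lra.
Qed.

(** Used to see that a partition of small mesh has more than [K] intervals. *)
Lemma last_le_path_size (delta a : R) (s : seq R) :
  path (fun x y => y - x < delta) a s -> last a s - a <= (size s)%:R * delta.
Proof.
elim: s a => [|b s IH] a /=; first by rewrite subrr mul0r.
by move=> /andP[ab /IH]; rewrite -natr1; lra.
Qed.

(** Turns convergence over all partitions into information on one interval: the terms outside it
    cancel in the difference of the two sums, and inserting nodes keeps the mesh below [delta]. *)
Lemma partition_insert (T delta a b : R) (s1 s2 l : seq R) :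
  itv_partition 0 T (s1 ++ b :: s2) -> mesh (s1 ++ b :: s2) < delta ->
  last 0 s1 = a -> path <%R a l -> last a l = b ->
  [/\ itv_partition 0 T (s1 ++ l ++ s2), mesh (s1 ++ l ++ s2) < delta &
      forall w, midpoint_term a b w - chain_sum a l w =
        chain_sum 0 (s1 ++ b :: s2) w - chain_sum 0 (s1 ++ l ++ s2) w].
Proof.
move=> [sp sl] sd s1a al lb.
have d0 : 0 < delta by apply: le_lt_trans sd; exact: bigmax_ge_id.
move: sp; rewrite cat_path s1a /= => /andP[s1p /andP[ab bs2]].
have := path_mesh sd; rewrite cat_path s1a /= => /andP[m1 /andP[mab mb]].
split.
- split; first by rewrite !cat_path s1p s1a al lb.
  by move: sl; rewrite !last_cat /= s1a lb.
- apply: mesh_path => //; rewrite !cat_path m1 s1a lb mb andbT /=.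
  by apply: path_mesh_lt => //; rewrite lb.
- by move=> w; rewrite !chain_sum_cat /= s1a lb; lra.
Qed.

Hypothesis mPhi :
  forall t : R, 0 <= t -> measurable_fun [set: R] (fun x => Phi x t).

Lemma measurable_midpoint_term (a b : R) : 0 <= a ->
  measurable_fun setT (midpoint_term a b).
Proof.
move=> a0; apply: measurable_funM; last exact: measurable_funB.
apply: (measurableT_comp (mPhi a0)).
by apply: measurable_funM => //; exact: measurable_funD.
Qed.

Lemma measurable_chain_sum (a : R) (l : seq R) : 0 <= a -> path <%R a l ->
  measurable_fun setT (chain_sum a l).
Proof.
elim: l a => [|b l IH] a a0 /=; first by move=> _; exact: measurable_cst.
move=> /andP[ab bl]; apply: measurable_funD; first exact: measurable_midpoint_term.
by apply: IH => //; exact: le_trans (ltW ab).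
Qed.

Hypothesis BM : standard_brownian_motion B.

Lemma ge0_integral_brownian (a : R) (f : R -> \bar R) : 0 < a ->
  (forall x, 0 <= f x)%E -> measurable_fun setT f ->
  (\int[P]_w f (B a w) = \int[normal_prob 0 (Num.sqrt a)]_x f x)%E.
Proof.
move=> a0 f0 mf.
pose X (w : Om) : measurableTypeR R := increment B 0 a w.
have mX : measurable_fun setT X by exact: measurable_funB.
transitivity (\int[P]_w f (X w))%E.
  apply: ge0_ae_eq_integral => //; try exact: measurableT_comp.
  move: (bm_start BM); apply: filterS => w Bw _.
  by rewrite /X /= /increment Bw subr0.
transitivity (\int[pushforward P X]_x f x)%E.
  by rewrite ge0_integral_pushforward.
apply: eq_measure_integral => A mA _.
have := bm_gaussian_increments BM (lexx 0) a0 mA.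
by rewrite subr0.
Qed.

Lemma independent_increments2 (a b : R) : 0 < a -> a < b ->
  forall A1 A2 : set R, measurable A1 -> measurable A2 ->
  P (increment B 0 a @^-1` A1 `&` increment B a b @^-1` A2) =
  (normal_prob 0 (Num.sqrt a) A1 * normal_prob 0 (Num.sqrt (b - a)) A2)%E.
Proof.
move=> a0 ab A1 A2 mA1 mA2.
(* The default values of [nth] supply the third time [b] and the second set [A2]. *)
pose t := nth b [:: 0; a].
pose A := nth A2 [:: A1].
have ti i : (i < 2)%N -> t i < t i.+1 by case: i => [|[]].
have mA i : measurable (A i) by case: i => [|[|]] //= i; rewrite /A nth_default.
have := bm_independent_increments BM (lexx 0 : 0 <= t 0%N) ti mA.
have -> : \bigcap_(i < 2) (increment B (t i) (t i.+1) @^-1` A i) =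
    increment B 0 a @^-1` A1 `&` increment B a b @^-1` A2.
  apply/seteqP; split => w.
    by move=> H; split; [exact: (H 0%N)|exact: (H 1%N)].
  by move=> [H0 H1] [|[|//]] _.
rewrite big_ord_recl big_ord1.
rewrite (bm_gaussian_increments BM (lexx 0) a0 mA1).
by rewrite (bm_gaussian_increments BM (ltW a0) ab mA2) subr0.
Qed.

(** With x = B_a and y = B_b - B_a, the term is Phi(x + y/2, a) y almost surely. For fixed y the
    shift estimate bounds the integral over x; the integral over y then uses that [b - a <= a]
    orders the two deviations. *)
Lemma sqnorm_midpoint_term_le (a b C : R) : 0 < a -> a < b -> b - a <= a ->
  ('E_P[fun w => (Phi (B a w) a ^+ 4)%R] <= C%:E)%E ->
  (sqnorm P (midpoint_term a b) <= (8 * (C + 1) * (b - a))%:E)%E.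
Proof.
move=> a0 ab baa; rewrite unlock => EC.
have ma := mPhi (ltW a0).
have ba0 : 0 < b - a by rewrite subr_gt0.
have C0 : 0 <= C.
  rewrite -lee_fin; apply: le_trans EC; apply: integral_ge0 => w _.
  by rewrite lee_fin exprn_even_ge0.
have {}EC : (\int[normal_prob 0 (Num.sqrt a)]_x (Phi x a ^+ 4)%:E <= C%:E)%E.
  rewrite -(ge0_integral_brownian a0 (f := fun x => (Phi x a ^+ 4)%:E))//.
    by move=> x; rewrite lee_fin exprn_even_ge0.
  by apply/measurable_EFinP; exact: measurable_funX.
pose f (z : R * R) := ((Phi (z.1 + z.2 / 2) a * z.2) ^+ 2)%:E.
have mX : measurable_fun setT (increment B 0 a) by exact: measurable_funB.
have mY : measurable_fun setT (increment B a b) by exact: measurable_funB.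
have f0 z : (0 <= f z)%E by rewrite lee_fin sqr_ge0.
have mf : measurable_fun setT f.
  apply/measurable_EFinP; apply: measurable_funX; apply: measurable_funM => //.
  apply: (measurableT_comp ma); apply: measurable_funD => //.
  exact: measurable_funM.
have -> : sqnorm P (midpoint_term a b) =
    (\int[P]_w f (increment B 0 a w, increment B a b w))%E.
  apply: ge0_ae_eq_integral => //.
  - by apply: measurable_EFin_sqr; apply: measurable_midpoint_term; exact: ltW.
  - by apply: measurableT_comp => //; exact/measurable_fun_pairP.
  - by move=> w _; rewrite lee_fin sqr_ge0.
  - move: (bm_start BM); apply: filterS => w Bw _.
    rewrite /f /= /midpoint_term /increment Bw subr0.
    congr ((Phi _ _ * _) ^+ 2)%:E.
    by lra.
rewrite (@ge0_integral_independent_pair _ _ _ _ _ _ _ P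
  (normal_prob 0 (Num.sqrt a)) (normal_prob 0 (Num.sqrt (b - a))) _ _ f
  mX mY (independent_increments2 a0 ab) f0 mf).
have s0 : 0 < Num.sqrt a by rewrite sqrtr_gt0.
have r0 : 0 < Num.sqrt (b - a) by rewrite sqrtr_gt0.
have rs : Num.sqrt (b - a) <= Num.sqrt a by exact: ler_wsqrtr.
have := integral_sqr_expR_normal_prob_le r0 rs C0.
rewrite (sqr_sqrtr (ltW ba0)); apply: le_trans; apply: ge0_le_integral => //.
- by move=> y _; apply: integral_ge0.
- exact: measurable_fun_fubini_tonelli_G.
- apply/measurable_EFinP/measurable_funM => //.
  apply: measurable_funM => //; apply: measurable_funD => //.
  apply: measurableT_comp => //; apply: measurable_funM => //.
  by apply: measurable_funX; exact: measurable_funM.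
move=> y _; rewrite EFinM.
under eq_integral do rewrite /f /= exprMn mulrC EFinM.
rewrite ge0_integralZl//; first last.
- by rewrite lee_fin sqr_ge0.
- by move=> x _; rewrite lee_fin sqr_ge0.
- apply: measurable_EFin_sqr; apply: (measurableT_comp ma).
  exact: measurable_funD.
rewrite lee_wpmul2l ?lee_fin ?sqr_ge0//.
exact: (normal_prob_shift_le (y / 2) s0 ma EC).
Qed.

(* The ratio condition of [sqnorm_midpoint_term_le] forces the subdivision to
   be geometric towards 0. *)
Lemma dyadic_refinement (T C : R) (n : nat) (a b : R) :
  (forall t : R, 0 <= t <= T ->
     ('E_P[fun w => (Phi (B t w) t ^+ 4)%R] <= C%:E)%E) -> 0 <= C ->
  0 < a -> a < b -> b <= T -> b <= a * 2 ^+ n ->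
  exists l, [/\ path <%R a l, last a l = b &
    (sqnorm P (chain_sum a l) <= (48 * (C + 1) * (b - a))%:E)%E].
Proof.
move=> EC C0; elim: n b => [|n IH] b a0 ab bT ban.
  by move: ban ab; rewrite expr0 mulr1 leNgt => /negP.
have term1 x y : 0 < x -> x < y -> y <= T -> y - x <= x ->
    (sqnorm P (midpoint_term x y) <= (8 * (C + 1) * (y - x))%:E)%E.
  move=> x0 xy yT yx; apply: sqnorm_midpoint_term_le => //.
  by apply: EC; rewrite ltW//= (le_trans (ltW xy)).
have [ba|ba] := leP (b - a) a.
  exists [:: b]; split => //=; first by rewrite ab.
  rewrite [X in sqnorm _ X](_ : _ = midpoint_term a b); last first.
    by apply/funext => w /=; rewrite addr0.
  apply: le_trans (term1 _ _ a0 ab bT ba) _; rewrite lee_fin.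
  by nra.
(* Here [b - a > a], so [b / 2] still exceeds [a]; the last interval, from [b / 2] to [b], just
   meets the ratio condition. *)
have [||||l [al lb lC]] := IH (b / 2) => //; [by lra..| |].
  by move: ban; rewrite exprS; lra.
exists (rcons l b); split.
- by rewrite rcons_path al lb; lra.
- by rewrite last_rcons.
rewrite [X in sqnorm _ X](_ : _ =
    chain_sum a l \+ midpoint_term (b / 2) b); last first.
  by apply/funext => w /=; rewrite -cats1 chain_sum_cat lb /= addr0.
have H := term1 (b / 2) b ltac:(lra) ltac:(lra) bT ltac:(lra).
apply: le_trans (sqnormD_le _ _ lC H) _.
- by apply: measurable_chain_sum => //; exact: ltW.
- by apply: measurable_midpoint_term; lra.
(* The constant 48 reproduces itself: 3/2 * 48 * (b/2 - a) + 3 * 8 * b/2 = 48 b - 72 a. *)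
by rewrite lee_fin; nra.
Qed.

End midpoint_terms.

(** * Single terms of a midpoint sum *)

Section single_terms.
Context d (Om : measurableType d) (R : realType) (P : probability Om R).
Variables (B : R -> {RV P >-> R}) (Phi : R -> R -> R).
Hypothesis mPhi :
  forall t : R, 0 <= t -> measurable_fun [set: R] (fun x => Phi x t).
Hypothesis BM : standard_brownian_motion B.
Hypothesis Phi0 : bounded_near (fun x => Phi x 0) (nbhs (0 : R)).
Variables (T C : R).
Hypothesis C0 : 0 <= C.
Hypothesis EC : forall t : R, 0 <= t <= T ->
  ('E_P[fun w => (Phi (B t w) t ^+ 4)%R] <= C%:E)%E.

(** Along almost every path the midpoint tends to 0, hence enters the neighbourhood where [Phi] at
    time 0 is bounded, while the increment vanishes. *)
Lemma midpoint_term_cvg0 (r : R^nat) : (forall k, 0 < r k) ->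
  r @ \oo --> 0 ->
  {ae P, forall w, midpoint_term B Phi 0 (r k) w @[k --> \oo] --> 0}.
Proof.
move=> r0 rcvg.
move: (bm_start BM) (bm_continuous_paths BM); apply: filterS2 => w B0 Bc.
have Br : B (r k) w @[k --> \oo] --> 0.
  have /continuous_within_itvcyP[_ Bc0] := Bc.
  rewrite -B0; apply: cvg_comp Bc0 => U /rcvg Ur.
  (* Continuity at time 0 is only from the right, which positivity of [r k] matches. *)
  apply: (filterS (P := fun k => 0 < r k -> U (r k))); last exact: Ur.
  by move=> k /(_ (r0 k)).
have [M M0 HM] := ex_strict_bound_gt0 Phi0.
apply/cvgr0Pnorm_le => e e0.
have Bh : (B 0 w + B (r k) w) / 2 @[k --> \oo] --> 0.
  rewrite [X in _ --> X](_ : _ = (0 + 0) / 2); last by rewrite addr0 mul0r.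
  by apply: cvgM; [apply: cvgD => //; rewrite B0; exact: cvg_cst|exact: cvg_cst].
have := Bh _ HM.
have e1 : 0 < e / M by rewrite divr_gt0.
move/cvgr0Pnorm_le : Br => /(_ _ e1); apply: filterS2 => k /= Bk Phik.
rewrite /midpoint_term B0 subr0 normrM.
apply: (@le_trans _ _ (M * (e / M))).
  by apply: ler_pM => //; rewrite B0 in Phik; exact: ltW.
by rewrite mulrC divfK// gt_eqF.
Qed.

(** The term is its difference to a dyadic subdivision, at most [9 / 2 * e], plus the sum of the
    subdivision, at most [48 * (C + 1) * delta]; the weights 3/2 and 3 of [sqnormD_le] give the
    constants. *)
Lemma sqnorm_midpoint_term_partition_le (e delta : R) (Y : Om -> R) :
  measurable_fun setT Y ->
  (forall s, itv_partition 0 T s -> mesh s < delta ->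
     (sqnorm P (chain_sum B Phi 0 s \- Y)%R <= e%:E)%E) ->
  forall s1 b s2, itv_partition 0 T (s1 ++ b :: s2) ->
    mesh (s1 ++ b :: s2) < delta ->
  (sqnorm P (midpoint_term B Phi (last 0 s1) b)%R <=
    (27 / 4 * e + 144 * (C + 1) * delta)%:E)%E.
Proof.
move=> mY H s1 b s2 ps ms; set a := last 0 s1.
have := ps; rewrite /itv_partition cat_path -/a /= last_cat /= => -[+ /eqP bT].
move=> /andP[p1 /andP[ab p2]].
have a0 : 0 <= a by apply: (@itv_partition_le _ _ _ _ s1); split.
have bleT : b <= T by apply: (@itv_partition_le _ _ _ _ s2); split => //; apply/eqP.
have bad : b - a < delta.
  by have := path_mesh ms; rewrite cat_path /= => /andP[_ /andP[]].
have mchain s : itv_partition 0 T s -> measurable_fun setT (chain_sum B Phi 0 s).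
  by move=> [s0 _]; exact: measurable_chain_sum.
have mterm : measurable_fun setT (midpoint_term B Phi a b).
  exact: measurable_midpoint_term.
have refine l : path <%R a l -> last a l = b ->
    (sqnorm P (midpoint_term B Phi a b \- chain_sum B Phi a l)%R <= (9 / 2 * e)%:E)%E.
  move=> al lb.
  have [ps' ms' sE] := partition_insert B Phi ps ms erefl al lb.
  set s := s1 ++ b :: s2 in ps ms sE *; set s' := s1 ++ l ++ s2 in ps' ms' sE *.
  rewrite [X in sqnorm _ X](_ : _ = (chain_sum B Phi 0 s \- Y) \+
      (\- (chain_sum B Phi 0 s' \- Y))); last first.
    by apply/funext => w /=; rewrite sE; lra.
  have := H _ ps' ms'; rewrite -sqnormN => Hs'.
  apply: le_trans (sqnormD_le _ _ (H _ ps ms) Hs') _.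
  - by apply: measurable_funB => //; exact: mchain.
  - by apply: measurableT_comp => //; apply: measurable_funB => //; exact: mchain.
  - by rewrite lee_fin; lra.
have [a_eq0|a_neq0] := eqVneq a 0; last first.
  have a_gt0 : 0 < a by rewrite lt_neqAle eq_sym a_neq0.
  (* Enough halvings to bring [b] down to [a], from n < 2^n. *)
  have ban : b <= a * 2 ^+ Num.bound (b / a).
    have ba0 : 0 <= b / a by rewrite divr_ge0// ltW// (le_lt_trans a0).
    rewrite mulrC -ler_pdivrMr// ltW// (lt_trans (archi_boundP ba0))//.
    by rewrite -natrX ltr_nat ltn_expl.
  have [l [al lb lC]] := dyadic_refinement mPhi BM EC C0 a_gt0 ab bleT ban.
  rewrite [X in sqnorm _ X](_ : _ = (midpoint_term B Phi a b \- chain_sum B Phi a l)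
      \+ chain_sum B Phi a l); last by apply/funext => w /=; rewrite subrK.
  have ml : measurable_fun setT (chain_sum B Phi a l) by exact: measurable_chain_sum.
  apply: le_trans (sqnormD_le (measurable_funB mterm ml) ml (refine l al lb) lC) _.
  have : (C + 1) * (b - a) <= (C + 1) * delta.
    by apply: ler_wpM2l; [exact: addr_ge0|exact: ltW].
  by rewrite lee_fin; lra.
rewrite a_eq0 in ab bad mterm refine *.
(* This is b / (k + 2); the shifted index keeps [r 0] strictly below [b]. *)
pose r k : R := b * harmonic k.+1.
have r0 k : 0 < r k by rewrite mulr_gt0// invr_gt0 ltr0n.
have rb k : r k < b.
  by rewrite gtr_pMr// invf_lt1 ?ltr0n// ltr1n.
have rcvg : r @ \oo --> 0.
  rewrite [X in _ --> X](_ : _ = b * 0); last by rewrite mulr0.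
  apply: cvgM; first exact: cvg_cst.
  by have := @cvg_harmonic R; rewrite -(@cvg_shiftS _ (@harmonic R)).
apply: (sqnorm_le_fatou (Z := fun k => midpoint_term B Phi 0 (r k))) => //.
- by move=> k; exact: measurable_midpoint_term.
- exact: midpoint_term_cvg0.
move=> k.
have rbn : b <= r k * 2 ^+ Num.bound (b / r k).
  have br0 : 0 <= b / r k by rewrite divr_ge0// ltW.
  rewrite mulrC -ler_pdivrMr// ltW// (lt_trans (archi_boundP br0))//.
  by rewrite -natrX ltr_nat ltn_expl.
have [l [al lb lC]] := dyadic_refinement mPhi BM EC C0 (r0 k) (rb k) bleT rbn.
have al' : path <%R 0 (r k :: l) by rewrite /= r0.
(* Subtracting the term of [0, r_k] leaves the refinement error plus the dyadic sum from r_k on,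
   bounded uniformly in [k] as Fatou's lemma requires. *)
rewrite [X in sqnorm _ X](_ : _ =
    (midpoint_term B Phi 0 b \- chain_sum B Phi 0 (r k :: l))
    \+ chain_sum B Phi (r k) l); last by apply/funext => w /=; lra.
have ml : measurable_fun setT (chain_sum B Phi (r k) l).
  by apply: measurable_chain_sum => //; exact: ltW.
have ml' : measurable_fun setT (chain_sum B Phi 0 (r k :: l)).
  exact: measurable_chain_sum.
apply: le_trans (sqnormD_le (measurable_funB mterm ml') ml (refine _ al' lb) lC) _.
have : (C + 1) * (b - r k) <= (C + 1) * delta.
  by apply: ler_wpM2l; [exact: addr_ge0|have := r0 k; lra].
by rewrite lee_fin; lra.
Qed.

End single_terms.

(** * Boundedness in L0, membership in L2, complementary sums *)

(** The intervals are disjoint, so at each time at most one term of the series is nonzero; [M + M]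
    crudely adds the bound for the part at time 0. The bound yields the fourth moment estimate for
    this class. *)
Lemma in_L0_bounded (d : measure_display) (Om : measurableType d) (R : realType)
    (F : R -> set (set Om)) (X : R -> Om -> R) : in_L0 F X ->
  exists M : R, forall t w, 0 <= t -> `|X t w| <= M.
Proof.
move=> [s [f [[s0 [smono _]] _ [M fM] XE]]]; exists (M + M) => t w t0.
have M0 : 0 <= M := le_trans (normr_ge0 _) (fM 0%N w).
rewrite XE//; apply: le_trans (ler_normD _ _) _; apply: lerD.
  rewrite normrM -[leRHS]mulr1; apply: ler_pM => //.
  by rewrite indicE; case: (_ \in _); rewrite ?normr1 ?normr0.
have smono' : nondecreasing_seq s by apply/nondecreasing_seqP => k; exact/ltW.
have [[k /= tk]|nt] := pselect (exists k, t \in `]s k, s k.+1]).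
  suff -> : limn (fun n => \sum_(0 <= k < n) f k w * \1_(`]s k, s k.+1]) t) = f k w.
    exact: fM.
  apply/cvg_lim => //; apply: cvg_near_cst; exists k.+1 => // n /= kn.
  rewrite big_mkord (bigD1 (Ordinal kn))//= big1 ?addr0.
    by rewrite indicE mem_set// mulr1.
  move=> i /eqP ik; rewrite indicE memNset ?mulr0// => /= ti.
  move: ti tk; rewrite !in_itv/= => /andP[t1 t2] /andP[t3 t4].
  have [ik'|ki|ik'] := ltngtP i k.
  - by have := smono' _ _ ik'; lra.
  - by have := smono' _ _ ki; lra.
  - by apply: ik; exact: val_inj.
rewrite [X in limn X](_ : _ = fun=> 0) ?lim_cst ?normr0//.
apply/funext => n; rewrite big1// => k _; rewrite indicE memNset ?mulr0//.
by move=> tk; apply: nt; exists k.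
Qed.

Lemma Lfun2_sqnormP (d : measure_display) (Om : measurableType d)
    (R : realType) (P : probability Om R) (X : Om -> R) :
  X \in Lfun P 2%:E <-> measurable_fun setT X /\ (sqnorm P X < +oo)%E.
Proof.
have XE : ('N[P]_2%:E [EFin \o X] = sqnorm P X `^ 2^-1)%E.
  rewrite unlock; congr (_ `^ _)%E; apply: eq_integral => w _ /=.
  by rewrite powR_mulrn// real_normK// num_real.
split => [XL|[mX Xoo]].
  split; first by have := sub_Lfun_mfun XL; rewrite inE.
  have := sub_Lfun_finLfun XL; rewrite inE/= /finite_norm XE.
  by apply: contraLR; rewrite -!leNgt !leye_eq => /eqP ->; rewrite poweRyr.
rewrite inE; apply/andP; split; rewrite inE//= /finite_norm XE.
by rewrite poweR_lty.
Qed.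

Lemma midpoint_sumC (d : measure_display) (Om : measurableType d)
    (R : realType) (B : R -> Om -> R) (Phi : R -> R -> R) (s : seq R)
    (A : {set 'I_(size s)}) (w : Om) :
  midpoint_sum B Phi (~: A)%SET w =
  midpoint_sum B Phi [set: 'I_(size s)]%SET w - midpoint_sum B Phi A w.
Proof.
rewrite /midpoint_sum; apply/eqP; rewrite eq_sym subr_eq eq_sym addrC.
rewrite [X in _ == X](bigID (fun j => j \in A)) /=; apply/eqP; congr (_ + _).
  by apply: eq_bigl => j; rewrite finset.in_setT.
by apply: eq_bigl => j; rewrite finset.in_setC finset.in_setT.
Qed.

(** * Removal of a fixed number of terms *)

Theorem theorem3 (R : realType) (d : measure_display) (Om : measurableType d)
    (P : probability Om R) (B : R -> {RV P >-> R}) (T : R)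
    (Phi : R -> R -> R) (K : nat) (JK : forall s : seq R, {set 'I_(size s)})
    (Y : Om -> R) :
  let F := brownian_filtration P B in
  let Phit := fun (t : R) (w : Om) => Phi (B t w) t in
  standard_brownian_motion B ->
  0 < T ->
  (forall t : R, 0 <= t -> measurable_fun [set: R] (fun x => Phi x t)) ->
  bounded_near (fun x => Phi x 0) (nbhs (0 : R)) ->
  adapted F Phit ->
  in_L0 F Phit \/
  (in_L2 P F T Phit /\
   exists C : R, forall t : R, 0 <= t <= T ->
     ('E_P[fun w => (Phit t w ^+ 4)%R] <= C%:E)%E) ->
  (1 <= K)%N ->
  (forall s : seq R, itv_partition 0 T s -> (K < size s)%N -> #|JK s| = K) ->
  is_stratonovich_integral P B T Phi Y ->
  lim_in_mean_square P (mesh_to_0 T)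
    (fun s => midpoint_sum B Phi (~: JK s)%SET) Y.
Proof.
move=> F Phit BM T0 mPhi Phi0 _ PhiL K1 JKcard [_ LY cvgS].
(* Both classes of integrands reduce to one bound on fourth moments. *)
have [C C0 EC] : exists2 C : R, 0 <= C & forall t : R, 0 <= t <= T ->
    ('E_P[fun w => (Phit t w ^+ 4)%R] <= C%:E)%E.
  have pow4_ge0 t : (0 <= 'E_P[fun w => (Phit t w ^+ 4)%R])%E.
    by apply: expectation_ge0 => w; rewrite exprn_even_ge0.
  case: PhiL => [/in_L0_bounded[M XM]|[_ [C EC]]]; last first.
    exists C => //; rewrite -lee_fin; apply: le_trans (pow4_ge0 0) (EC 0 _).
    by rewrite lexx ltW.
  exists (M ^+ 4) => [|t /andP[t0 _]]; first by rewrite exprn_even_ge0.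
  rewrite -(expectation_cst P (M ^+ 4)); apply: expectation_le.
  - by apply: measurable_funX; apply: (measurableT_comp (mPhi _ t0)).
  - exact: measurable_cst.
  - by move=> w; rewrite exprn_even_ge0.
  - by move=> w; rewrite exprn_even_ge0.
  - apply: nearW => w; have := XM t w t0.
    rewrite -[Phit t w ^+ 4]ger0_norm ?exprn_even_ge0// normrX => XMw.
    by rewrite lerXn2r ?nnegrE// (le_trans _ XMw).
have [mY Yoo] := (Lfun2_sqnormP P Y).1 LY.
have full_sum_cvg (e : R) : 0 < e -> exists2 delta : R, 0 < delta &
    forall s, itv_partition 0 T s -> mesh s < delta ->
    (sqnorm P (chain_sum B Phi 0 s \- Y)%R <= e%:E)%E.
  move=> e0.
  have /cvgS[delta delta0 sdelta] : nbhs 0%E [set x : \bar R | (x <= e%:E)%E].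
    exists e => //= r; rewrite /ball_/= sub0r normrN lee_fin => re.
    exact: le_trans (ler_norm r) (ltW re).
  exists delta => // s ps ms; have := sdelta s ps ms.
  by rewrite /= unlock midpoint_sum_setT.
have JK_sum_cvg (e : R) : 0 < e -> exists2 delta : R, 0 < delta &
    forall s, itv_partition 0 T s -> mesh s < delta ->
    measurable_fun setT (midpoint_sum B Phi (JK s)) /\
    (sqnorm P (midpoint_sum B Phi (JK s)) <= e%:E)%E.
  (* Each term will cost at most 27/4 e1 + e1 <= 8 e1, and summing [K] of them multiplies by 5^K. *)
  move=> e0; pose e1 := e / (8 * 5 ^+ K).
  have e10 : 0 < e1 by rewrite divr_gt0// mulr_gt0// exprn_gt0.
  have [delta delta0 fulls] := full_sum_cvg e1 e10.
  have C10 : 0 < 144 * (C + 1) by rewrite mulr_gt0// ltr_wpDl.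
  (* The three bounds bring full sums close to [Y], make the part of the single-term estimate linear
     in the mesh at most [e1], and force more than [K] intervals. *)
  exists (Num.min delta (Num.min (e1 / (144 * (C + 1))) (T / K.+1%:R))).
    by rewrite !lt_min delta0 !divr_gt0.
  move=> s ps; rewrite !lt_min => /and3P[ms1 ms2 ms3].
  have Ks : (K < size s)%N.
    have := last_le_path_size (path_mesh ms3); have [_ /eqP ->] := ps.
    rewrite subr0 mulrA ler_pdivlMr ?ltr0n// mulrC ler_pM2r// ler_nat.
    by [].
  have card_JK := JKcard s ps Ks.
  pose X (j : 'I_(size s)) := midpoint_term B Phi (node s j) (node s j.+1).
  (* The node 0 is not stored in [s], so node j+1 sits at position j of [s]. *)
  have splits (j : 'I_(size s)) :
      take j s ++ node s j.+1 :: drop j.+1 s = s /\ last 0 (take j s) = node s j.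
    split; first by rewrite /node /= -drop_nth// cat_take_drop.
    rewrite /node; case: j => -[|j] /= js; first by rewrite take0.
    by rewrite (take_nth 0) ?last_rcons// ltnW.
  have mX j : measurable_fun setT (X j).
    have [sE lastE] := splits j.
    apply: measurable_midpoint_term => //; rewrite -lastE.
    apply: (@itv_partition_le _ _ _ _ (take j s)); split => //.
    by have := ps; rewrite -{1}sE => -[]; rewrite cat_path => /andP[].
  have X_le j : (sqnorm P (X j) <= (8 * e1)%:E)%E.
    have [sE lastE] := splits j.
    have := sqnorm_midpoint_term_partition_le mPhi BM Phi0 C0 EC mY
      (e := e1) (delta := Num.min delta (e1 / (144 * (C + 1)))) _
      (s1 := take j s) (b := node s j.+1) (s2 := drop j.+1 s).
    rewrite sE lastE => /(_ _ ps) => H.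
    apply: le_trans (H _ _) _.
    - by move=> s' ps'; rewrite lt_min => /andP[ms' _]; exact: fulls.
    - by rewrite lt_min ms1.
    - rewrite lee_fin.
      have : 144 * (C + 1) * Num.min delta (e1 / (144 * (C + 1))) <= e1.
        by rewrite mulrC -ler_pdivlMr// ge_min lexx orbT.
      lra.
  have sumE : midpoint_sum B Phi (JK s) = fun w => \sum_(j <- enum (JK s)) X j w.
    by apply/funext => w; rewrite big_enum.
  rewrite sumE; split; first exact: measurable_sum.
  apply: le_trans (sqnorm_sum_le _ mX _ X_le) _; first by rewrite mulr_ge0// ltW.
  rewrite lee_fin -cardE card_JK /e1 le_eqVlt; apply/orP; left; apply/eqP.
  by field; rewrite expf_neq0.
have main (e : R) : 0 < e -> exists2 delta : R, 0 < delta &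
    forall s, itv_partition 0 T s -> mesh s < delta ->
    measurable_fun setT (midpoint_sum B Phi (~: JK s)%SET) /\
    (sqnorm P (midpoint_sum B Phi (~: JK s)%SET \- Y)%R <= e%:E)%E.
  (* The weights 3/2 and 3 add up to less than 5. *)
  move=> e0; have e50 : 0 < e / 5 by rewrite divr_gt0.
  have [d1 d10 fulls] := full_sum_cvg _ e50.
  have [d2 d20 JKs] := JK_sum_cvg _ e50.
  exists (Num.min d1 d2); first by rewrite lt_min d10.
  move=> s ps; rewrite lt_min => /andP[ms1 ms2].
  have [mJ J_le] := JKs s ps ms2.
  have mS : measurable_fun setT (chain_sum B Phi 0 s).
    by case: ps => ps _; exact: measurable_chain_sum.
  have sumE w : midpoint_sum B Phi (~: JK s)%SET w =
      chain_sum B Phi 0 s w - midpoint_sum B Phi (JK s) w.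
    by rewrite midpoint_sumC midpoint_sum_setT.
  split; first by rewrite (funext sumE); exact: measurable_funB.
  rewrite [X in sqnorm _ X](_ : _ = (chain_sum B Phi 0 s \- Y) \+
    (\- midpoint_sum B Phi (JK s))); last first.
    by apply/funext => w /=; rewrite sumE addrAC.
  have J_le' : (sqnorm P (\- midpoint_sum B Phi (JK s))%R <= (e / 5)%:E)%E.
    by rewrite sqnormN.
  apply: le_trans (sqnormD_le _ _ (fulls s ps ms1) J_le') _.
  - exact: measurable_funB.
  - exact: measurableT_comp.
  - by rewrite lee_fin; lra.
split => //.
  (* Any finite distance to [Y] suffices for square integrability; 1 is an arbitrary choice. *)
  have [delta delta0 sdelta] := main 1 ltr01.
  exists delta => // s ps ms /=; have [mS S_le] := sdelta s ps ms.
  apply/(Lfun2_sqnormP P); split => //.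
  rewrite [X in sqnorm _ X](_ : _ = (midpoint_sum B Phi (~: JK s)%SET \- Y) \+ Y);
    last by apply/funext => w /=; rewrite subrK.
  have Y_le : (sqnorm P Y <= (fine (sqnorm P Y))%:E)%E.
    by rewrite fineK// ge0_fin_numE// sqnorm_ge0.
  apply: le_lt_trans (sqnormD_le _ mY S_le Y_le) (ltry _).
  exact: measurable_funB.
move=> U /= [e /= e0 eU].
have e20 : 0 < e / 2 by rewrite divr_gt0.
have [delta delta0 sdelta] := main _ e20.
exists delta => // s ps ms /=; have [_ S_le] := sdelta s ps ms.
rewrite unlock; rewrite -/(sqnorm P (midpoint_sum B Phi (~: JK s)%SET \- Y)).
have sq_fin : sqnorm P (midpoint_sum B Phi (~: JK s)%SET \- Y) \is a fin_num.
  by rewrite ge0_fin_numE ?sqnorm_ge0// (le_lt_trans S_le) ?ltry.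
rewrite -(fineK sq_fin); apply: eU; rewrite /ball_/= sub0r normrN.
rewrite ger0_norm ?fine_ge0 ?sqnorm_ge0//.
by rewrite -lte_fin fineK// (le_lt_trans S_le)// lte_fin; lra.
Qed.
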